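(* Let $\Lambda$ be a row-finite $k$-graph without sources such that the talented monoid $T_\Lambda$ is atomic. Then the following assertions are equivalent: (i) $\Lambda$ is aperiodic; (ii) each atom of $T_\Lambda$ is aperiodic; (iii) $\mathbb{Z}^k$ acts freely on $T_\Lambda$.
   Context: **$k$-graphs.** $\mathbb{N}=\{0,1,2,\dots\}$, $k\ge 1$, $e_i$ is the $i$-th standard generator of $\mathbb{N}^k$; $\mathbb{N}^k$ is ordered coordinatewise, with $m\vee n$ the coordinatewise maximum. A $k$-graph is a countable small category $\Lambda$ with object set $\Lambda^0$ (identified with the identity morphisms), range and source maps $r,s:\Lambda\to\Lambda^0$, and a functor $d:\Lambda\to\mathbb{N}^k$ with the unique factorization property: if $d(\lambda)=m+n$ there are unique $\mu_1,\mu_2\in\Lambda$ with $\lambda=\mu_1\mu_2$, $d(\mu_1)=m$, $d(\mu_2)=n$ (the product $\mu_1\mu_2$ is defined iff $s(\mu_1)=r(\mu_2)$). For $v\in\Lambda^0$, $n\in\mathbb{N}^k$: $v\Lambda=r^{-1}(v)$ and $v\Lambda^n=\{\lambda\in v\Lambda: d(\lambda)=n\}$. $\Lambda$ is row-finite if every $v\Lambda^n$ is finite, and has no sources if every $v\Lambda^n$ is nonempty. **Talented monoid.** $T_\Lambda$ is the commutative monoid generated by symbols $v(n)$ ($v\in\Lambda^0$, $n\in\mathbb{Z}^k$) subject to $v(n)=\sum_{\alpha\in v\Lambda^{e_i}}s(\alpha)(n+e_i)$ for all $v$, $n$ and $i\in\{1,\dots,k\}$ with $v\Lambda^{e_i}\neq\emptyset$.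 $\mathbb{Z}^k$ acts on $T_\Lambda$ by monoid automorphisms determined by ${}^{n}v(m)=v(m+n)$. A nonzero $a\in T_\Lambda$ is periodic if ${}^{n}a=a$ for some $0\ne n\in\mathbb{Z}^k$, and aperiodic otherwise; $\mathbb{Z}^k$ acts freely on $T_\Lambda$ if there is no (nonzero) periodic element. **Atoms.** In a commutative monoid $M$ with $x\le y$ iff $y=x+z$ for some $z\in M$, a unit is an element $u\le 0$; a nonunit $a$ is an atom if $a=b+c$ implies $b$ or $c$ is a unit; $M$ is atomic if every nonunit is a finite sum of atoms. ($T_\Lambda$ is conical: $0$ is its only unit.) **Aperiodicity of $\Lambda$ (Lewin–Sims).** For $0\le m\le n\le d(\lambda)$, $\lambda(m,n)$ denotes the unique path $\mu_2$ with $\lambda=\mu_1\mu_2\mu_3$, $d(\mu_1)=m$, $d(\mu_2)=n-m$. $\mathrm{MCE}(\lambda,\mu)$ is the set of $\tau\in\Lambda$ with $d(\tau)=d(\lambda)\vee d(\mu)$, $\tau(0,d(\lambda))=\lambda$, $\tau(0,d(\mu))=\mu$. $\Lambda$ is aperiodic if for every pair of distinct paths $\alpha,\beta\in\Lambda$ with $s(\alpha)=s(\beta)$ there is $\tau\in s(\alpha)\Lambda$ with $\mathrm{MCE}(\alpha\tau,\beta\tau)=\emptyset$. *)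

(* Defs.v *)
From HB Require Import structures.
From mathcomp Require Import all_boot all_order all_algebra.
From mathcomp Require Import finmap.
From mathcomp Require Import boolp classical_sets functions cardinality.
From mathcomp Require Import generic_quotient.

Set Implicit Arguments.
Unset Strict Implicit.
Unset Printing Implicit Defensive.

Import GRing.Theory.
Local Open Scope classical_set_scope.
Local Open Scope quotient_scope.
Local Open Scope ring_scope.

Notation "''NN_' k" := {ffun 'I_k -> nat}
  (at level 8, k at level 2, format "''NN_' k") : type_scope.
Notation "''ZZ_' k" := {ffun 'I_k -> int}
  (at level 8, k at level 2, format "''ZZ_' k") : type_scope.

Definition basisN (k : nat) (i : 'I_k) : 'NN_k := [ffun j => nat_of_bool (j == i)].
Definition joinN (k : nat) (m n : 'NN_k) : 'NN_k := [ffun i => maxn (m i) (n i)].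
Definition NtoZ (k : nat) (n : 'NN_k) : 'ZZ_k := [ffun i => (n i)%:Z].

(* Composition is a total function, but it is only constrained on composable  *)
(* pairs (src a = rng b); its other values are junk, and are never used.      *)
Record kgraph (k : nat) := KGraph {
  vertex : countType;
  kpath : countType;
  rng : kpath -> vertex;
  src : kpath -> vertex;
  idp : vertex -> kpath;
  kcomp : kpath -> kpath -> kpath;
  deg : kpath -> 'NN_k;
  rng_idp : forall v, rng (idp v) = v;
  src_idp : forall v, src (idp v) = v;
  rng_comp : forall a b, src a = rng b -> rng (kcomp a b) = rng a;
  src_comp : forall a b, src a = rng b -> src (kcomp a b) = src b;
  comp_idl : forall a, kcomp (idp (rng a)) a = a;
  comp_idr : forall a, kcomp a (idp (src a)) = a;
  compA : forall a b c, src a = rng b -> src b = rng c ->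
    kcomp a (kcomp b c) = kcomp (kcomp a b) c;
  deg_idp : forall v, deg (idp v) = 0;
  deg_comp : forall a b, src a = rng b -> deg (kcomp a b) = deg a + deg b;
  factorization : forall l m n, deg l = m + n ->
    exists! p : kpath * kpath,
      [/\ src p.1 = rng p.2, l = kcomp p.1 p.2, deg p.1 = m & deg p.2 = n]
}.

Section KGraphNotions.
Variables (k : nat) (L : kgraph k).

Definition paths_from (v : vertex L) (n : 'NN_k) : set (kpath L) :=
  [set l | rng l = v /\ deg l = n].

Definition row_finite : Prop := forall v n, finite_set (paths_from v n).
Definition no_sources : Prop := forall v n, paths_from v n !=set0.

(* [is_segment l m n u] means u = l(m, n); the condition m + deg u = n says   *)
(* that m <= n and deg u = n - m.                                             *)
Definition is_segment (l : kpath L) (m n : 'NN_k) (u : kpath L) : Prop :=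
  exists a b : kpath L,
    [/\ src a = rng u, src u = rng b, l = kcomp (kcomp a u) b,
        deg a = m & m + deg u = n].

Definition MCE (l u : kpath L) : set (kpath L) :=
  [set t | [/\ deg t = joinN (deg l) (deg u),
               is_segment t 0 (deg l) l & is_segment t 0 (deg u) u]].

Definition aperiodic_kgraph : Prop :=
  forall a b : kpath L, a <> b -> src a = src b ->
    exists t : kpath L, rng t = src a /\ MCE (kcomp a t) (kcomp b t) = set0.

(* The symbol v(n) is the pair (v, n), and a word on the symbols stands for   *)
(* the sum of its letters; [talented_cong] is the least congruence making     *)
(* concatenation commutative and containing the defining relations.           *)
Definition symbol : Type := (vertex L * 'ZZ_k)%type.
HB.instance Definition _ := Choice.on symbol.

Inductive talented_cong : seq symbol -> seq symbol -> Prop :=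
| tc_refl x : talented_cong x x
| tc_sym x y : talented_cong x y -> talented_cong y x
| tc_trans x y z :
    talented_cong x y -> talented_cong y z -> talented_cong x z
| tc_cat x x' y y' :
    talented_cong x x' -> talented_cong y y' ->
    talented_cong (x ++ y) (x' ++ y')
| tc_comm x y : talented_cong (x ++ y) (y ++ x)
| tc_rel (v : vertex L) (n : 'ZZ_k) (i : 'I_k) :
    finite_set (paths_from v (basisN i)) -> paths_from v (basisN i) !=set0 ->
    talented_cong [:: (v, n)]
      [seq (src a, n + NtoZ (basisN i)) | a <- fset_set (paths_from v (basisN i))].

Definition talented_rel : rel (seq symbol) := fun x y => `[< talented_cong x y >].

Lemma talented_rel_refl : reflexive talented_rel.
Proof. by move=> x; apply/asboolP/tc_refl. Qed.

Lemma talented_rel_sym : symmetric talented_rel.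
Proof. by move=> x y; apply/asboolP/asboolP; apply: tc_sym. Qed.

Lemma talented_rel_trans : transitive talented_rel.
Proof. by move=> y x z /asboolP xy /asboolP yz; apply/asboolP/(tc_trans xy). Qed.

Definition talented_equiv :=
  EquivRel talented_rel talented_rel_refl talented_rel_sym talented_rel_trans.

Definition talented : Type := {eq_quot talented_equiv}.
HB.instance Definition _ := Choice.on talented.
HB.instance Definition _ := EqQuotient.on talented.

Lemma talentedP (x y : seq symbol) :
  talented_cong x y <-> \pi_talented x = \pi_talented y.
Proof.
split=> [xy|/eqquotP /asboolP//].
by apply/eqquotP/asboolP.
Qed.

Lemma talented_repr (x : seq symbol) :
  talented_cong (repr (\pi_talented x)) x.
Proof. by apply/talentedP; rewrite reprK. Qed.

Lemma talentedW (P : talented -> Prop) :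
  (forall x, P (\pi_talented x)) -> forall a, P a.
Proof. by move=> Px a; rewrite -[a]reprK; apply: Px. Qed.

Definition talented_zero : talented := \pi_talented [::].
Definition talented_add (a b : talented) : talented :=
  \pi_talented (repr a ++ repr b).

Lemma talented_add_pi (x y : seq symbol) :
  talented_add (\pi_talented x) (\pi_talented y) = \pi_talented (x ++ y).
Proof. by apply/talentedP/tc_cat; apply: talented_repr. Qed.

Lemma talented_addA : associative talented_add.
Proof.
move=> a b c; elim/talentedW: a => x; elim/talentedW: b => y; elim/talentedW: c => z.
by rewrite !talented_add_pi catA.
Qed.

Lemma talented_addC : commutative talented_add.
Proof.
by move=> a b; elim/talentedW: a => x; elim/talentedW: b => y; rewrite !talented_add_pi; apply/talentedP/tc_comm.
Qed.

Lemma talented_add0 : left_id talented_zero talented_add.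
Proof. by move=> a; elim/talentedW: a => x; rewrite talented_add_pi. Qed.

HB.instance Definition _ :=
  GRing.isNmodule.Build talented talented_addA talented_addC talented_add0.

Definition gen (v : vertex L) (n : 'ZZ_k) : talented := \pi_talented [:: (v, n)].

Definition shift_word (n : 'ZZ_k) (x : seq symbol) : seq symbol :=
  [seq (p.1, p.2 + n) | p <- x].

Definition shift (n : 'ZZ_k) (a : talented) : talented :=
  \pi_talented (shift_word n (repr a)).

Lemma shift_word_cong (n : 'ZZ_k) (x y : seq symbol) :
  talented_cong x y -> talented_cong (shift_word n x) (shift_word n y).
Proof.
elim=> {x y} [x|x y _|x y z _ + _|x x' y y' _ xx' _ yy'|x y|v m i fin ne].
- exact: tc_refl.
- exact: tc_sym.
- exact: tc_trans.
- by rewrite /shift_word !map_cat; apply: tc_cat.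
- by rewrite /shift_word !map_cat; apply: tc_comm.
- rewrite /shift_word -map_comp /=.
  under eq_map => a do rewrite /= addrAC.
  exact: tc_rel.
Qed.

Lemma shift_pi (n : 'ZZ_k) (x : seq symbol) :
  shift n (\pi_talented x) = \pi_talented (shift_word n x).
Proof. exact/talentedP/shift_word_cong/talented_repr. Qed.

Lemma shift_gen (n : 'ZZ_k) (v : vertex L) (m : 'ZZ_k) :
  shift n (gen v m) = gen v (m + n).
Proof. exact: shift_pi. Qed.

Lemma shift0n (n : 'ZZ_k) : shift n 0 = 0.
Proof. exact: shift_pi. Qed.

Lemma shiftD (n : 'ZZ_k) : {morph shift n : a b / a + b}.
Proof.
move=> a b; elim/talentedW: a => x; elim/talentedW: b => y.
rewrite /GRing.add /= talented_add_pi !shift_pi talented_add_pi.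
by rewrite /shift_word map_cat.
Qed.

Lemma shift0 (a : talented) : shift 0 a = a.
Proof.
elim/talentedW: a => x; rewrite shift_pi /shift_word map_id_in// => -[v m] _ /=.
by rewrite addr0.
Qed.

Lemma shift_shift (m n : 'ZZ_k) (a : talented) :
  shift m (shift n a) = shift (m + n) a.
Proof.
elim/talentedW: a => x; rewrite !shift_pi /shift_word -map_comp; congr \pi.
by apply: eq_map => -[v p] /=; rewrite (addrC m) addrA.
Qed.

Lemma pi_sum (x : seq symbol) : \pi_talented x = \sum_(p <- x) gen p.1 p.2.
Proof.
elim: x => [|[v n] x IHx]; first by rewrite big_nil.
by rewrite big_cons -IHx [RHS]talented_add_pi.
Qed.

Lemma gen_rel (v : vertex L) (n : 'ZZ_k) (i : 'I_k) :
  finite_set (paths_from v (basisN i)) -> paths_from v (basisN i) !=set0 ->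
  gen v n = \sum_(a <- fset_set (paths_from v (basisN i)))
              gen (src a) (n + NtoZ (basisN i)).
Proof.
move=> fin ne; have /talentedP := tc_rel n fin ne.
by rewrite [RHS]pi_sum big_map.
Qed.

Definition periodic (a : talented) : Prop :=
  a <> 0 /\ exists n : 'ZZ_k, n <> 0 /\ shift n a = a.

Definition aperiodic_elt (a : talented) : Prop := a <> 0 /\ ~ periodic a.

Definition acts_freely : Prop := ~ exists a : talented, periodic a.

End KGraphNotions.

Section MonoidNotions.
Variable M : nmodType.

Definition mon_le (x y : M) : Prop := exists z : M, y = x + z.
Definition mon_unit (u : M) : Prop := mon_le u 0.
Definition atom (a : M) : Prop :=
  ~ mon_unit a /\ forall b c : M, a = b + c -> mon_unit b \/ mon_unit c.
Definition atomic : Prop :=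
  forall a : M, ~ mon_unit a ->
    exists s : seq M, (forall x, x \in s -> atom x) /\ a = \sum_(x <- s) x.

End MonoidNotions.
Arguments atomic M : clear implicits.

(* Main.v *)
Require Import Defs.
From mathcomp Require Import all_boot all_order all_algebra.
From mathcomp Require Import finmap.
From mathcomp Require Import boolp classical_sets cardinality.
From mathcomp Require Import zify.
From mathcomp Require Import zify.

(** In a row-finite [k]-graph without sources, [v(n)] is the sum of the
    [s(alpha)(n + p)], for [alpha] in [v Lambda^p], whatever [p] is ([gen_srcs]).
    Hence any word can be pushed to a common level [N], where it becomes a finite
    multiset of vertices ([push]), and two words represent the same element of
    the talented monoid iff their multisets agree at all high enough levels
    ([push_cong], [pi_push]). This has the following consequences.

    The monoid is conical, and its atoms are exactly the [v(n)] with [v] a linear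
    vertex, that is, one with a single path of each degree starting from it
    ([atom_gen], [gen_atom]). At a high enough level an atom is a single vertex,
    and so the atoms that occur in a sum of atoms are determined by the sum
    ([atom_mem_sum]).

    Freeness: if a nonzero [a] is fixed by the shift by [n <> 0] and is a sum of
    atoms, then all the shifts by multiples of [n] of one of these atoms occur
    among the finitely many atoms of the sum. So two of them agree, and that atom
    is periodic.

    Aperiodicity of the graph: if [v(n)] is a periodic atom, two paths [alpha],
    [beta] of distinct degrees start at [v] and have the same source, and as [v]
    is linear, [alpha tau] and [beta tau] always have a common extension.
    Conversely, let [alpha <> beta] have the same source [w]. As the monoid is
    atomic, some path [tau] starting at [w] ends at a linear vertex [u]. If
    [alpha tau] and [beta tau] have a common extension, then either the degrees
    of [alpha] and [beta] agree and [alpha = beta], or the atom [u(0)] is fixed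
    by the shift by the difference of these degrees. *)

Set Implicit Arguments.
Unset Strict Implicit.
Unset Printing Implicit Defensive.

Import Order.TTheory GRing.Theory Num.Theory.
Local Open Scope classical_set_scope.
Local Open Scope quotient_scope.
Local Open Scope ring_scope.

(** * Multidegrees *)

Section Degrees.
Variable k : nat.
Implicit Types (m n p : 'NN_k) (x y z : 'ZZ_k).

(** The coordinatewise order on [Z^k]. *)
Definition leZ x y : Prop := forall i, x i <= y i.

(** The distance between [x] and [y]; it is the difference [y - x], as a
    multidegree, when [x] is below [y]. *)
Definition gapN x y : 'NN_k := [ffun i => `|y i - x i|%N].

(** The coordinatewise maximum on [Z^k]. *)
Definition joinZ x y : 'ZZ_k := [ffun i => Num.max (x i) (y i)].

Lemma leZ_trans y x z : leZ x y -> leZ y z -> leZ x z.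
Proof. by move=> xy yz i; apply: le_trans (xy i) (yz i). Qed.

Lemma leZ_joinl x y : leZ x (joinZ x y).
Proof. by move=> i; rewrite ffunE le_max lexx. Qed.

Lemma leZ_joinr x y : leZ y (joinZ x y).
Proof. by move=> i; rewrite ffunE le_max lexx orbT. Qed.

Lemma NtoZD m n : NtoZ (m + n) = NtoZ m + NtoZ n.
Proof. by apply/ffunP => i; rewrite !ffunE. Qed.

Lemma NtoZ_inj : injective (@NtoZ k).
Proof.
by move=> m n /ffunP mn; apply/ffunP => i; have := mn i; rewrite !ffunE => -[].
Qed.

Lemma gapNK x y : leZ x y -> x + NtoZ (gapN x y) = y.
Proof.
move=> xy; apply/ffunP => i; rewrite !ffunE.
have gapK (a b : int) : a <= b -> a + `|b - a|%N%:Z = b by lia.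
exact: gapK (xy i).
Qed.

Lemma gapND x y n : leZ (x + NtoZ n) y -> gapN x y = n + gapN (x + NtoZ n) y.
Proof.
move=> xy; apply/ffunP => i; have := xy i; rewrite !ffunE.
have gapD (a b : int) (d : nat) : a + d%:Z <= b ->
  `|b - a|%N = (d + `|b - (a + d%:Z)%R|)%N by lia.
exact: gapD.
Qed.

Lemma joinN_splitl m n : exists p, joinN m n = m + p.
Proof.
exists [ffun i => (maxn (m i) (n i) - m i)%N]; apply/ffunP => i; rewrite !ffunE.
exact/esym/subnKC/leq_maxl.
Qed.

Lemma joinNC m n : joinN m n = joinN n m.
Proof. by apply/ffunP => i; rewrite !ffunE maxnC. Qed.

Lemma NN_ind (P : 'NN_k -> Prop) :
  P 0 -> (forall i n, P n -> P (basisN i + n)) -> forall n, P n.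
Proof.
move=> P0 PS n; have [d] := ubnP (\sum_i n i)%N.
elim: d n => // d IHd n; rewrite ltnS => le_n.
have [->//|/eqP n0] := pselect (n = 0).
have [i ni] : exists i, n i != 0%N.
  apply: contrapT => /forallNP n_0; move/eqP: n0; apply.
  by apply/ffunP => i; rewrite ffunE; have /negP := n_0 i; rewrite negbK => /eqP.
have -> : n = basisN i + [ffun j => (n j - (j == i))%N].
  apply/ffunP => j; rewrite !ffunE -[RHS]/(addn _ _) subnKC//.
  by case: eqVneq => // ->; rewrite lt0n.
apply/PS/IHd/(leq_trans _ le_n).
rewrite (bigD1 i)//= [ltnRHS](bigD1 i)//= ffunE eqxx.
rewrite [X in (_ + X < _)%N](_ : _ = \sum_(j | j != i) n j)%N.
  by rewrite ltn_add2r ltn_subrL; move: ni; rewrite -lt0n.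
by apply: eq_bigr => j /negPf ji; rewrite ffunE ji subn0.
Qed.

Lemma mulrn_ZZ_neq0 x d : x <> 0 -> (0 < d)%N -> x *+ d <> 0.
Proof.
move=> x0 d0 /ffunP xd; apply: x0; apply/ffunP => i.
have := xd i; rewrite ffunMnE !ffunE => /eqP.
by rewrite mulrn_eq0 => /orP[|/eqP//]; rewrite eqn0Ngt d0.
Qed.

End Degrees.

(** * Paths *)

Section Paths.
Variables (k : nat) (L : kgraph k).
Implicit Types (v w : vertex L) (a b c t : kpath L) (m n p q : 'NN_k).

(** The uniqueness part of the factorization property, as a cancellation law. *)
Lemma kcomp_inj a b a' b' : src a = rng b -> src a' = rng b' ->
  deg a = deg a' -> kcomp a b = kcomp a' b' -> a = a' /\ b = b'.
Proof.
move=> ab ab' da eab; have db : deg b = deg b'.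
  have := congr1 (@deg _ L) eab; rewrite !deg_comp// da => /ffunP e.
  by apply/ffunP => i; have := e i; rewrite !ffunE => /addnI.
have [x [_ xP]] := factorization (deg_comp ab).
have e1 := xP (a, b) (And4 ab erefl erefl erefl).
have e2 := xP (a', b') (And4 ab' eab (esym da) (esym db)).
by have [-> ->] : (a, b) = (a', b') by rewrite -e1 -e2.
Qed.

Lemma kcomp_split c m n : deg c = m + n ->
  exists a b, [/\ src a = rng b, c = kcomp a b, deg a = m & deg b = n].
Proof. by move=> /factorization [[a b] [abP _]]; exists a, b. Qed.

Lemma deg_eq0 a : deg a = 0 -> a = idp (rng a).
Proof.
move=> a0; have [] // := @kcomp_inj a (idp (src a)) (idp (rng a)) a.
- by rewrite rng_idp.
- by rewrite src_idp.
- by rewrite deg_idp.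
- by rewrite comp_idl comp_idr.
Qed.

Lemma initial_segment t a :
  is_segment t 0 (deg a) a <-> exists2 b, src a = rng b & t = kcomp a b.
Proof.
split=> [[i [b [ia ab -> i0 _]]]|[b ab ->]].
  by exists b; rewrite // (deg_eq0 i0) -(src_idp (rng i)) -(deg_eq0 i0) ia comp_idl.
exists (idp (rng a)), b; split; rewrite ?src_idp ?comp_idl ?deg_idp//.
exact: add0r.
Qed.

End Paths.

Section RowFinite.
Variables (k : nat) (L : kgraph k).
Hypotheses (Lfin : row_finite L) (Lsrc : no_sources L).
Implicit Types (v w u : vertex L) (a b c t : kpath L) (m n p q : 'NN_k).
Implicit Types (x y z : 'ZZ_k) (s : seq (symbol L)).

(** The finite set [v Lambda^p], as a list without repetition. *)
Definition paths v p : seq (kpath L) := fset_set (paths_from v p).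

Lemma mem_paths v p a : (a \in paths v p) <-> rng a = v /\ deg a = p.
Proof. by rewrite /paths in_fset_set//; split => [/set_mem//|?]; rewrite inE. Qed.

Lemma pathsD v p q :
  perm_eq (paths v (p + q)) [seq kcomp a b | a <- paths v p, b <- paths (src a) q].
Proof.
apply: uniq_perm; first exact: fset_uniq.
  apply: allpairs_uniq_dep => [|a _|]; rewrite ?fset_uniq//.
  move=> _ _ /allpairsPdep[a [b [/mem_paths[_ da] /mem_paths[rb _] ->]]]
    /allpairsPdep[a' [b' [/mem_paths[_ da'] /mem_paths[rb' _] ->]]] /= e.
  by have [-> ->] := kcomp_inj (esym rb) (esym rb') (etrans da (esym da')) e.
move=> c; apply/idP/allpairsPdep => [/mem_paths[rc]|].
  move=> /kcomp_split[a [b [ab ec da db]]].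
  exists a, b; split=> //; apply/mem_paths => //.
  by rewrite -rc ec rng_comp.
move=> [a [b [/mem_paths[ra da] /mem_paths[rb db] ->]]]; apply/mem_paths.
by rewrite rng_comp// deg_comp// ra da db.
Qed.

Lemma paths0 v : paths v 0 = [:: idp v].
Proof.
apply: perm_small_eq => //; apply: uniq_perm => [||a]; rewrite ?fset_uniq//.
rewrite inE; apply/idP/eqP => [/mem_paths[<- /deg_eq0]//|->].
by apply/mem_paths; rewrite rng_idp deg_idp.
Qed.

(** The multiset of the sources of the paths of degree [p] from [v]. *)
Definition srcs v p : seq (vertex L) := [seq src a | a <- paths v p].

Lemma srcs0 v : srcs v 0 = [:: v].
Proof. by rewrite /srcs paths0 /= src_idp. Qed.

Lemma srcsD v p q :
  perm_eq (srcs v (p + q)) (flatten [seq srcs w q | w <- srcs v p]).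
Proof.
apply: perm_trans (perm_map _ (pathsD v p q)) _.
rewrite map_flatten -!map_comp.
have e a : (map (@src _ L) \o (fun a => [seq kcomp a b | b <- paths (src a) q])) a
    = srcs (src a) q.
  by rewrite /= -map_comp; apply/eq_in_map => b /mem_paths[rb _] /=; rewrite src_comp.
by rewrite (eq_map e).
Qed.

Lemma srcs_neq_nil v p : srcs v p <> [::].
Proof.
have [a /mem_paths] := Lsrc v p.
by rewrite /srcs; case: (paths v p).
Qed.

(** * Words pushed to a common level *)

(** The multiset of the vertices [w] such that [w(x)] occurs when the letters of
    [s] are expanded up to level [x]. It is meaningful only if no letter of [s]
    lies beyond level [x]. *)
Definition push x s : seq (vertex L) :=
  flatten [seq srcs i.1 (gapN i.2 x) | i <- s].

Lemma push_cat x s s' : push x (s ++ s') = push x s ++ push x s'.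
Proof. by rewrite /push map_cat flatten_cat. Qed.

Lemma push1 x v y : push x [:: (v, y)] = srcs v (gapN y x).
Proof. by rewrite /push /= cats0. Qed.

Lemma mem_push x s w :
  reflect (exists2 i, i \in s & w \in srcs i.1 (gapN i.2 x)) (w \in push x s).
Proof. exact: flatten_mapP. Qed.

Lemma push_cong s s' : talented_cong s s' ->
  exists x, forall y, leZ x y -> perm_eq (push y s) (push y s').
Proof.
elim=> {s s'} [s|s s' _ [x sx]|s1 s2 s3 _ [x sx] _ [y sy]
              |s1 s2 s3 s4 _ [x sx] _ [y sy]|s s'|v n i fin ne].
- by exists 0.
- by exists x => y xy; rewrite perm_sym; apply: sx.
- exists (joinZ x y) => z xyz; apply: perm_trans (sx _ _) (sy _ _).
    exact: leZ_trans (leZ_joinl _ _) xyz.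
  exact: leZ_trans (leZ_joinr _ _) xyz.
- exists (joinZ x y) => z xyz; rewrite !push_cat; apply: perm_cat.
    by apply: sx; apply: leZ_trans (leZ_joinl _ _) xyz.
  by apply: sy; apply: leZ_trans (leZ_joinr _ _) xyz.
- by exists 0 => y _; rewrite !push_cat perm_catC.
- exists (n + NtoZ (basisN i)) => y ny.
  rewrite push1 (gapND ny); apply: perm_trans (srcsD _ _ _) _.
  by rewrite /push /srcs -!map_comp.
Qed.

(** The defining relations, extended from the [e_i] to all degrees. *)
Lemma gen_srcs v x p : gen v x = \sum_(w <- srcs v p) gen w (x + NtoZ p).
Proof.
elim/NN_ind: p v x => [|i p IHp] v x.
  rewrite srcs0 big_seq1; congr gen.
  by apply/ffunP => i; rewrite !ffunE addr0.
rewrite (perm_big _ (srcsD _ _ _))/= big_flatten /= !big_map.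
rewrite (gen_rel x (Lfin v (basisN i)) (Lsrc v (basisN i))).
by apply: eq_bigr => a _; rewrite (IHp (src a)) NtoZD addrA.
Qed.

Lemma pi_push s x : (forall i, i \in s -> leZ i.2 x) ->
  \pi_(talented L) s = \sum_(w <- push x s) gen w x.
Proof.
move=> sx; rewrite pi_sum big_flatten big_map big_seq [RHS]big_seq.
by apply: eq_bigr => -[v y] /sx /gapNK /= e; rewrite (gen_srcs v y (gapN y x)) e.
Qed.

Lemma leZ_bound s : exists x, forall i, i \in s -> leZ i.2 x.
Proof.
elim: s => [|[v y] s [x sx]]; first by exists 0.
exists (joinZ y x) => i /[!inE] /orP[/eqP->|/sx ix]; first exact: leZ_joinl.
exact: leZ_trans ix (leZ_joinr _ _).
Qed.

(** Equal elements have equal multisets at some level beyond all the letters. *)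
Lemma pi_eq_push s s' : \pi_(talented L) s = \pi_(talented L) s' ->
  exists x, [/\ perm_eq (push x s) (push x s'), forall i, i \in s -> leZ i.2 x
    & forall i, i \in s' -> leZ i.2 x].
Proof.
move=> /talentedP /push_cong[x sx].
have [y sy] := leZ_bound (s ++ s').
exists (joinZ x y); split=> [|i si|i si]; first exact/sx/leZ_joinl.
- by apply: leZ_trans (leZ_joinr _ _); apply: sy; rewrite mem_cat si.
- by apply: leZ_trans (leZ_joinr _ _); apply: sy; rewrite mem_cat si orbT.
Qed.

(** As there are no sources, pushing a nonempty word yields a nonempty multiset;
    hence the talented monoid is conical. *)
Lemma pi_eq0 s : \pi_(talented L) s = 0 -> s = [::].
Proof.
move=> /(@pi_eq_push _ [::])[x [/perm_nilP]].
case: s => // -[v y] s /=; rewrite -cat1s push_cat push1.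
by case: srcs (@srcs_neq_nil v (gapN y x)).
Qed.

Lemma gen_neq0 v x : gen v x <> 0.
Proof. by move=> /pi_eq0. Qed.

Lemma talented_unit (a : talented L) : mon_unit a <-> a = 0.
Proof.
split=> [[b]|->]; last by exists 0; rewrite addr0.
elim/talentedW: a => s; elim/talentedW: b => s'.
rewrite /GRing.add /= talented_add_pi => /esym /pi_eq0.
by case: s.
Qed.

(** * Linear vertices and atoms *)

(** A vertex is linear if there is at most one path, hence exactly one, of each
    degree starting from it. *)
Definition linear_vertex v : Prop :=
  forall a b, rng a = v -> rng b = v -> deg a = deg b -> a = b.

Lemma linear_srcs a : linear_vertex (rng a) -> srcs (rng a) (deg a) = [:: src a].
Proof.
move=> lin; rewrite /srcs (_ : paths _ _ = [:: a])//.
apply: perm_small_eq => //; apply: uniq_perm => [||b]; rewrite ?fset_uniq//.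
rewrite inE; apply/idP/eqP => [/mem_paths[rb db]|->]; last exact/mem_paths.
exact: lin.
Qed.

Lemma linear_srcs1 v p : linear_vertex v -> exists w, srcs v p = [:: w].
Proof. by have [a [<- <-]] := Lsrc v p => lin; exists (src a); apply: linear_srcs. Qed.

Lemma linear_src a : linear_vertex (rng a) -> linear_vertex (src a).
Proof.
move=> lin b c ab ac bc.
have [||||_ -> //] := @kcomp_inj _ L a b a c => //.
by apply: lin; rewrite ?rng_comp// !deg_comp// bc.
Qed.

Lemma gen_linear a x : linear_vertex (rng a) ->
  gen (rng a) x = gen (src a) (x + NtoZ (deg a)).
Proof. by move=> lin; rewrite (gen_srcs _ _ (deg a)) linear_srcs// big_seq1. Qed.

Lemma linear_mem_srcs v p w : linear_vertex v -> w \in srcs v p ->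
  linear_vertex w /\ forall x, gen v x = gen w (x + NtoZ p).
Proof.
move=> lin /mapP[a /mem_paths[rv <-] ->]; move: lin; rewrite -rv => lin.
by split; [apply: linear_src | move=> x; apply: gen_linear].
Qed.

(** As no generator is a unit, an atom that is a nonempty sum of generators is a
    single generator. *)
Lemma atom_sum_gen (w : vertex L) (ws : seq (vertex L)) x :
  atom (\sum_(u <- w :: ws) gen u x) -> ws = [::].
Proof.
move=> [_ /(_ (gen w x) (\sum_(u <- ws) gen u x))].
rewrite big_cons => /(_ erefl)[/talented_unit /gen_neq0//|/talented_unit].
case: ws => // u ws.
by rewrite -(big_map (pair^~ x) predT (fun i => gen i.1 i.2)) -pi_sum => /pi_eq0.
Qed.

Lemma atom_gen (a : talented L) : atom a ->
  exists v x, linear_vertex v /\ a = gen v x.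
Proof.
elim/talentedW: a => s at_s; have [x sx] := leZ_bound s.
move: at_s; rewrite (pi_push sx).
case: (push x s) => [[[]]|v ws at_s].
  by rewrite big_nil; apply/talented_unit.
move: at_s (atom_sum_gen at_s) => /[swap] ->; rewrite big_seq1 => at_v.
exists v, x; split=> // a b ra rb dab.
have := at_v; rewrite (gen_srcs v x (deg a)).
have : a \in paths v (deg a) by apply/mem_paths.
have : b \in paths v (deg a) by apply/mem_paths.
rewrite /srcs; case: (paths v (deg a)) => // c [|c' cs].
  by rewrite !inE => /eqP-> /eqP->.
by move=> _ _ /atom_sum_gen.
Qed.

Lemma gen_atom v x : linear_vertex v -> atom (gen v x).
Proof.
move=> lin; split=> [/talented_unit/gen_neq0//|b c].
elim/talentedW: b => s; elim/talentedW: c => s'.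
rewrite [_ + _]talented_add_pi => /pi_eq_push[y [+ _ _]].
rewrite push1; have [w ->] := linear_srcs1 (gapN x y) lin.
move=> /perm_size; rewrite push_cat size_cat /= => sz.
have push0 (t : seq (symbol L)) : push y t = [::] -> t = [::].
  by case: t => // i t; rewrite /push /=; case: srcs (@srcs_neq_nil i.1 (gapN i.2 y)).
have [/eqP|s0] := eqVneq (size (push y s)) 0%N.
  by rewrite size_eq0 => /eqP/push0 ->; left; apply/talented_unit.
have /eqP : size (push y s') = 0%N by lia.
by rewrite size_eq0 => /eqP/push0 ->; right; apply/talented_unit.
Qed.

Lemma shift_atom x (a : talented L) : atom a -> atom (shift x a).
Proof. by move=> /atom_gen[v [y [lin ->]]]; rewrite shift_gen; apply: gen_atom. Qed.

(** A sum of atoms is represented by a word whose letters are these atoms. *)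
Lemma sum_atoms_word (r : seq (talented L)) :
  (forall a : talented L, a \in r -> atom a) ->
  exists2 s, \sum_(a <- r) a = \pi_(talented L) s
    & forall i, i \in s -> linear_vertex i.1 /\ gen i.1 i.2 \in r.
Proof.
elim: r => [|a r IHr] at_r; first by exists [::] => //; rewrite big_nil.
have [|s rs sP] := IHr; first by move=> b rb; apply: at_r; rewrite inE rb orbT.
have [v [x [lin av]]] := atom_gen (at_r a (mem_head _ _)).
exists ((v, x) :: s) => [|i].
  by rewrite big_cons rs av [LHS]talented_add_pi.
rewrite !inE => /orP[/eqP->|/sP[li ->]]; first by rewrite av eqxx.
by rewrite orbT.
Qed.

(** An atom below a sum of atoms is one of its terms: at a high level, the atom
    and the terms become single vertices. *)
Lemma atom_mem_sum (a b : talented L) (r : seq (talented L)) :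
  atom a -> (forall c : talented L, c \in r -> atom c) ->
  a + b = \sum_(c <- r) c -> a \in r.
Proof.
move=> /atom_gen[v [x [lin ->]]] /sum_atoms_word[s -> sP].
elim/talentedW: b => s'; rewrite [_ + _]talented_add_pi => /pi_eq_push[y [e vy sy]].
have [w vw] := linear_srcs1 (gapN x y) lin.
have : w \in push y ([:: (v, x)] ++ s').
  by rewrite push_cat push1 vw mem_head.
rewrite (perm_mem e) => /mem_push[i si wi].
have [li ri] := sP i si.
have wv : w \in srcs v (gapN x y) by rewrite vw mem_head.
have [_ /(_ x)] := linear_mem_srcs lin wv.
have [_ /(_ i.2)] := linear_mem_srcs li wi.
by rewrite (gapNK (sy _ si)) (gapNK (vy (v, x) (mem_head _ _))) => <- ->.
Qed.

(** * Periodicity *)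

Lemma shift_mulrn x (a : talented L) d : shift x a = a -> shift (x *+ d) a = a.
Proof.
move=> xa; elim: d => [|d IHd]; first by rewrite mulr0n shift0.
by rewrite mulrS -shift_shift IHd.
Qed.

Lemma periodic_sum_atoms (a : talented L) (r : seq (talented L)) :
  periodic a -> (forall b : talented L, b \in r -> atom b) -> a = \sum_(b <- r) b ->
  exists2 b, b \in r & periodic b.
Proof.
case: r => [|b r] [a0 [x [x0 xa]]] at_r ar; first by move: a0; rewrite ar big_nil.
exists b; first exact: mem_head.
have at_b := at_r b (mem_head _ _).
have ab : a = b + \sum_(c <- r) c by rewrite ar big_cons.
(* The shifts of [b] by the multiples of [x] lie in the finite list, so they
   cannot be pairwise distinct. *)
pose orb := [seq shift (x *+ d) b | d <- iota 0 (size (b :: r)).+1].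
have orb_r : {subset orb <= b :: r}.
  move=> _ /mapP[d _ ->].
  apply: (@atom_mem_sum _ (shift (x *+ d) (\sum_(c <- r) c))) => //.
    exact: shift_atom.
  by rewrite -ar -shiftD -ab shift_mulrn.
have /(uniqPn 0)[i [j [ij]]] : ~~ uniq orb.
  by apply/negP => /uniq_leq_size /(_ orb_r); rewrite size_map size_iota ltnn.
rewrite size_map size_iota => jr.
rewrite !(nth_map 0%N) ?size_iota//; last exact: ltn_trans jr.
rewrite !nth_iota//; last exact: ltn_trans jr.
rewrite !add0n => eij.
split; first by case: at_b => + _ b0; apply; apply/talented_unit.
exists (x *+ (j - i)); split; first by apply: mulrn_ZZ_neq0; rewrite ?subn_gt0.
rewrite mulrnBr ?(ltnW ij)// addrC -shift_shift -eij shift_shift addNr.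
exact: shift0.
Qed.

Lemma aperiodic_elt_atoms : aperiodic_kgraph L ->
  forall a : talented L, atom a -> aperiodic_elt a.
Proof.
move=> Lap _ /atom_gen[v [x [lin ->]]]; split; first exact: gen_neq0.
move=> [_ [n [n0]]]; rewrite shift_gen => /pi_eq_push[y [e vn vy]].
have [a [ra da]] := Lsrc v (gapN (x + n) y).
have [b [rb db]] := Lsrc v (gapN x y).
(* Pushed to the level [y], the words for [v(x + n)] and [v(x)] become the sources
   of [a] and [b]. *)
have [xny xy] : leZ (x + n) y /\ leZ x y.
  by split; [apply: vn (mem_head _ _)|apply: vy (mem_head _ _)].
have sab : src a = src b.
  move: e lin; rewrite !push1 -da -db -{1}ra -{1}rb => e lin.
  move: e; rewrite !linear_srcs ?ra ?rb// => /perm_mem /(_ (src a)).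
  by rewrite !inE eqxx => /esym/eqP.
have nab : a <> b.
  move=> ab; apply: n0; apply: (addrI x); rewrite addr0.
  have := gapNK xny; rewrite -{2}(gapNK xy) -da ab db => /addIr; exact.
have [t [rt mce]] := Lap a b nab sab.
have rat : rng (kcomp a t) = v by rewrite rng_comp.
have rbt : rng (kcomp b t) = v by rewrite rng_comp ?rb// -sab.
(* As [v] is linear, any path from [v] extends all the paths from [v] of smaller
   degree. *)
have ext c c' p : rng c = v -> rng c' = v -> deg c' = deg c + p ->
    is_segment c' 0 (deg c) c.
  move=> rc rc' /kcomp_split[c1 [c2 [c12 ec d1 _]]]; apply/initial_segment.
  have <- : c1 = c by apply: lin => //; rewrite -rc' ec rng_comp.
  by exists c2.
have [c [rc dc]] := Lsrc v (joinN (deg (kcomp a t)) (deg (kcomp b t))).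
suff : MCE (kcomp a t) (kcomp b t) c by rewrite mce.
have [p ep] := joinN_splitl (deg (kcomp a t)) (deg (kcomp b t)).
have [q eq] := joinN_splitl (deg (kcomp b t)) (deg (kcomp a t)).
split=> //.
- by apply: (ext _ _ p) => //; rewrite dc ep.
- by apply: (ext _ _ q) => //; rewrite dc joinNC eq.
Qed.

Lemma atomic_linear_src v : atomic (talented L) ->
  exists2 t, rng t = v & linear_vertex (src t).
Proof.
move=> /(_ (gen v 0))[/talented_unit/gen_neq0//|r [/sum_atoms_word[s -> sP]]].
move=> /pi_eq_push[x [e _ _]].
have [t [rt dt]] := Lsrc v (gapN 0 x).
exists t => //.
have : src t \in push x [:: (v, 0)].
  by rewrite push1; apply: map_f; apply/mem_paths.
rewrite (perm_mem e) => /mem_push[i /sP[li _]].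
by case/(linear_mem_srcs li).
Qed.

Lemma aperiodic_kgraph_atoms : atomic (talented L) ->
  (forall a : talented L, atom a -> aperiodic_elt a) -> aperiodic_kgraph L.
Proof.
move=> Tat ap a b nab sab.
have [t rt lin] := atomic_linear_src (src a) Tat.
exists t; split=> //; apply/seteqP; split=> // c.
have sat : src a = rng t by [].
have sbt : src b = rng t by rewrite -sab.
move=> [_ /initial_segment[a' sa' ea] /initial_segment[b' sb' eb]].
rewrite src_comp// in sa'; rewrite src_comp// in sb'.
have e : kcomp a (kcomp t a') = kcomp b (kcomp t b').
  by rewrite !Defs.compA// -ea -eb.
have [dab|dab] := pselect (deg a = deg b).
  by apply: nab; case: (kcomp_inj _ _ dab e) => //; rewrite rng_comp.
have [_ []] := ap _ (gen_atom 0 lin); split; first exact: gen_neq0.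
have eqs : src a' = src b'.
  by have := congr1 (@src _ L) e; rewrite !src_comp ?rng_comp.
(* Expanding the atom [gen (src t) 0] along [a'] and along [b'] leads to the same
   vertex at two levels. *)
have ga : gen (src t) 0 = gen (src a') (NtoZ (deg a')).
  by rewrite sa' gen_linear -?sa'// add0r.
have gb : gen (src t) 0 = gen (src a') (NtoZ (deg b')).
  by rewrite eqs sb' gen_linear -?sb'// add0r.
exists (NtoZ (deg a') - NtoZ (deg b')); split; last first.
  by rewrite {1}gb shift_gen addrC subrK.
move=> /eqP; rewrite subr_eq0 => /eqP /NtoZ_inj dab'; apply: dab.
have := congr1 (@deg _ L) e; rewrite !deg_comp ?rng_comp// dab' => /ffunP ed.
by apply/ffunP => i; have := ed i; rewrite !ffunE => /addIn.
Qed.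

End RowFinite.

Theorem theorem5p9 (k : nat) (k_gt0 : (0 < k)%N) (L : kgraph k)
    (Lfin : row_finite L) (Lsrc : no_sources L)
    (Tatomic : atomic (talented L)) :
  (aperiodic_kgraph L <-> (forall a : talented L, atom a -> aperiodic_elt a)) /\
  ((forall a : talented L, atom a -> aperiodic_elt a) <-> acts_freely L).
Proof.
split; split.
- exact: aperiodic_elt_atoms.
- exact: aperiodic_kgraph_atoms.
- move=> ap [a a_per]; have [a0 _] := a_per.
  have [|r [at_r ar]] := Tatomic a; first by move=> /(talented_unit Lfin Lsrc).
  have [b rb b_per] := periodic_sum_atoms Lfin Lsrc a_per at_r ar.
  by have [_ []] := ap b (at_r b rb).
- move=> free a [na _]; split=> [a0|a_per]; last by apply: free; exists a.
  by apply: na; apply/(talented_unit Lfin Lsrc).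
Qed.
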